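(* Let $k$ be a positive integer and suppose $H_1, H_2, \ldots, H_k$ are $k$ pairwise vertex disjoint copies of the star $K_{1,k}$. If $G = \sum_{i=1}^k H_i$ is the disjoint union of $H_1, \ldots, H_k$, then $G$ is not proportionally $k$-choosable.
   Context: All graphs are finite and simple. For a positive integer $k$, a $k$-assignment $L$ for a graph $G$ assigns to each vertex $v$ a set $L(v)$ of exactly $k$ colors; its palette is $\mathcal{L} = \bigcup_{v \in V(G)} L(v)$, and for $c \in \mathcal{L}$, $\eta(c) = |\{v \in V(G) : c \in L(v)\}|$. A proper $L$-coloring of $G$ is a proper coloring $f$ of $G$ with $f(v) \in L(v)$ for every vertex $v$. It is a proportional $L$-coloring if for every $c \in \mathcal{L}$, $|f^{-1}(c)|$ equals $\lfloor \eta(c)/k \rfloor$ or $\lceil \eta(c)/k \rceil$. $G$ is proportionally $k$-choosable if a proportional $L$-coloring of $G$ exists for every $k$-assignment $L$ for $G$. *)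

(* Defs.v *)
From mathcomp Require Import all_boot.

Set Implicit Arguments.
Unset Strict Implicit.
Unset Printing Implicit Defensive.

Record sgraph := SGraph {
  vertex :> finType;
  adj : rel vertex;
  adj_sym : symmetric adj;
  adj_irr : irreflexive adj
}.

Definition isomorphic (G H : sgraph) : Prop :=
  exists2 h : G -> H, bijective h & forall u v, adj (h u) (h v) = adj u v.

Section CompleteBipartite.
Variables m n : nat.

Definition Kmn_adj : rel ('I_m + 'I_n)%type := fun u v =>
  match u, v with
  | inl _, inr _ | inr _, inl _ => true
  | _, _ => false
  end.

Lemma Kmn_adj_sym : symmetric Kmn_adj.
Proof. by case=> i [] j. Qed.

Lemma Kmn_adj_irr : irreflexive Kmn_adj.
Proof. by case. Qed.

Definition complete_bipartite := SGraph Kmn_adj_sym Kmn_adj_irr.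

End CompleteBipartite.

Section DisjointUnion.
Variables (I : finType) (H : I -> sgraph).

(* [tagged_as u v] is the vertex of [v] once [u] and [v] are known to lie in
   the same component graph. *)
Definition dunion_adj : rel {i : I & H i} := fun u v =>
  (tag u == tag v) && adj (tagged u) (tagged_as u v).

Lemma dunion_adj_sym : symmetric dunion_adj.
Proof.
move=> [i x] [j y]; rewrite /dunion_adj /= eq_sym.
have [ji|//] := eqVneq j i; case: i / ji x => x.
by rewrite !tagged_asE adj_sym.
Qed.

Lemma dunion_adj_irr : irreflexive dunion_adj.
Proof. by move=> [i x]; rewrite /dunion_adj tagged_asE adj_irr andbF. Qed.

Definition disjoint_union := SGraph dunion_adj_sym dunion_adj_irr.

End DisjointUnion.

Definition divn_ceil (m d : nat) : nat := m %/ d + ~~ (d %| m).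

Section ListColoring.
Variables (G : sgraph) (C : finType).
Implicit Types (L : G -> {set C}) (f : G -> C).

Definition assignment (k : nat) L : Prop := forall v, #|L v| = k.

Definition palette L : {set C} := \bigcup_v L v.

Definition eta L (c : C) : nat := #|[set v | c \in L v]|.

Definition proper_coloring f : Prop := forall u v, adj u v -> f u != f v.

Definition proper_list_coloring L f : Prop :=
  proper_coloring f /\ forall v, f v \in L v.

Definition proportional_coloring (k : nat) L f : Prop :=
  proper_list_coloring L f /\
  forall c, c \in palette L ->
    #|[set v | f v == c]| = eta L c %/ k \/
    #|[set v | f v == c]| = divn_ceil (eta L c) k.

End ListColoring.

(* The colors range over an arbitrary finite type; since G is finite, so is
   every palette, hence no assignment is lost. *)
Definition proportionally_choosable (G : sgraph) (k : nat) : Prop :=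
  forall (C : finType) (L : G -> {set C}),
    assignment k L -> exists f : G -> C, proportional_coloring k L f.

(* Main.v *)
Require Import Defs.
From mathcomp Require Import all_boot.

(** Group the [k * k.+1] vertices into [k.+1] classes of size [k]: the [k]
    centers form one class, and the leaves of each star form another. The list
    of a vertex consists of a color shared by all vertices and of [k - 1] colors
    private to its class. A private color is available at exactly [k] vertices,
    so it is used exactly once; hence every class contains a vertex with the
    shared color. In particular some center has it, and so does one of the
    leaves of the same star. *)

Section ClassLists.
Variables (G : sgraph) (T : finType) (g : G -> T) (n : nat).

(* [None] is the shared color; [Some (t, j)] is private to the class [t]. *)
Definition class_lists (v : G) : {set option (T * 'I_n)} :=
  None |: [set Some (g v, j) | j : 'I_n].

Lemma class_lists_assignment : assignment n.+1 class_lists.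
Proof.
move=> v; rewrite cardsU1 card_imset; last by move=> i j [].
have /negPf-> : None \notin [set Some (g v, j) | j : 'I_n].
  by apply/imsetP => -[].
by rewrite card_ord.
Qed.

Lemma mem_class_lists v t j :
  (Some (t, j) \in class_lists v) = (g v == t).
Proof.
rewrite !inE /=; apply/imsetP/eqP => [[i _ []] //|<-].
by exists j.
Qed.

Hypothesis card_class : forall t, #|[set v | g v == t]| = n.+1.

Lemma eta_class_lists t j : eta class_lists (Some (t, j)) = n.+1.
Proof.
rewrite -(card_class t) /eta; apply: eq_card => v.
by rewrite inE [RHS]inE -(mem_class_lists v t j).
Qed.

Lemma shared_color_in_class t f :
  proportional_coloring n.+1 class_lists f -> exists2 v, g v = t & f v = None.
Proof.
move=> [[_ fL] fprop].
have used_once j : #|[set v | f v == Some (t, j)]| = 1.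
  have in_palette : Some (t, j) \in palette class_lists.
    have /card_gt0P[v] : 0 < #|[set v | g v == t]| by rewrite card_class.
    by rewrite inE => gv; apply/bigcupP; exists v; rewrite // mem_class_lists.
  (* Here [eta] equals [n.+1], so the floor and the ceiling of the quotient are both 1. *)
  have := fprop _ in_palette.
  by rewrite eta_class_lists /divn_ceil divnn dvdnn => -[].
have [/existsP[v /andP[/eqP gv /eqP fv]]|no_shared] :=
  boolP [exists v, (g v == t) && (f v == None)]; first by exists v.
have f_private v : g v = t -> f v \in [set Some (t, j) | j : 'I_n].
  move=> gv; have := fL v; rewrite !inE gv => /orP[fv|//].
  by case/existsP: no_shared; exists v; rewrite gv eqxx.
(* Pigeonhole: without the shared color, [f] would send the [n.+1] vertices of the class injectively
   to its [n] private colors. *)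
have f_inj : {in [set v | g v == t] &, injective f}.
  move=> u v; rewrite !inE => /eqP/f_private/imsetP[j _ fu] _ fuv.
  have /eq_leq/card_le1_eqP := used_once j.
  by apply; rewrite inE -?fuv fu.
have : #|f @: [set v | g v == t]| <= #|[set Some (t, j) | j : 'I_n]|.
  apply/subset_leq_card/subsetP => _ /imsetP[v + ->].
  by rewrite inE => /eqP/f_private.
rewrite (card_in_imset f_inj) card_class card_imset; last by move=> i j [].
by rewrite card_ord ltnn.
Qed.

End ClassLists.

Theorem proposition27 (k : nat) (H : 'I_k -> sgraph) :
  0 < k ->
  (forall i : 'I_k, isomorphic (H i) (complete_bipartite 1 k)) ->
  ~ proportionally_choosable (disjoint_union H) k.
Proof.
case: k H => // n H _ isoH choosable.
have /fin_all_exists[h hP] i : exists h : H i -> complete_bipartite 1 n.+1,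
    bijective h /\ forall u v, adj (h u) (h v) = adj u v.
  by have [h] := isoH i; exists h.
have /fin_all_exists[e eP] i : exists e : complete_bipartite 1 n.+1 -> H i,
    cancel (h i) e /\ cancel e (h i).
  by have [[e] ? ? _] := hP i; exists e.
(* [None] is the class of all centers, [Some i] that of the leaves of star [i]. *)
pose g (v : disjoint_union H) : option 'I_n.+1 :=
  if h (tag v) (tagged v) is inl _ then None else Some (tag v).
have card_g t : #|[set v | g v == t]| = n.+1.
  (* [r] enumerates class [t]: by leaf within star [i] if [t] is [Some i], by star if [t] is
     [None]. *)
  pose r (j : 'I_n.+1) : disjoint_union H :=
    if t is Some i then Tagged H (e i (inr j)) else Tagged H (e j (inl ord0)).
  have r_inj : injective r.
    rewrite /r; case: t {r} => [i|] j1 j2 /eqP.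
      rewrite -tag_eqE /tag_eq /= eqxx tagged_asE.
      by move=> /eqP/(can_inj (eP i).2)[].
    by rewrite -tag_eqE => /andP[/eqP].
  rewrite -[RHS]card_ord -(card_imset _ r_inj); apply: eq_card => v.
  rewrite inE; apply/eqP/imsetP => [gv|[j _ ->]].
    rewrite /r -gv /g; case: v {gv} => i u /=.
    by case: (h i u) ((eP i).1 u) => j <-; [exists i; rewrite ?(ord1 j) | exists j].
  by rewrite /r /g; case: t {r r_inj} => [i|] /=; rewrite (eP _).2.
have [f f_prop] := choosable _ _ (class_lists_assignment _ _ g n).
(* The center [u] with the shared color determines the star [i] whose leaf class is used next. *)
have [[i u] gu fu] := shared_color_in_class _ _ _ _ card_g None f f_prop.
have [[i' w] gw fw] := shared_color_in_class _ _ _ _ card_g (Some i) f f_prop.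
move: gu gw; rewrite /g /=.
case hu: (h i u) => [a|//] _; case hw: (h i' w) => [//|b] [i'i].
(* Identifying the indices puts [u] and [w] in the same star, so that their adjacency can be
   computed there. *)
case: i / i'i u fu hu => u fu hu.
have [[proper _] _] := f_prop.
have := proper (Tagged H u) (Tagged H w).
rewrite fu fw eqxx /= /dunion_adj /= eqxx tagged_asE -(hP _).2 hu hw.
by move=> /(_ isT).
Qed.
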